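(* Let $S$ be an idempotent semiring with zero $\mathbf 0$ and unity $\mathbf 1$ whose strong interval extension $\mathcal I(S)$ is well-defined, let $\mathbf A\in \mathrm{Mat}_{nn}(\mathcal I(S))$ and $\mathbf B\in \mathrm{Mat}_{ns}(\mathcal I(S))$, and suppose that the closure matrix $A^*$ exists for every $A\in\mathbf A$. Then the sharp outer interval estimate $\mathbf A^*\mathbf B$ of the united minimal solution set $\Sigma_{\min}(\mathbf A,\mathbf B)$ (i.e. the least interval of matrices containing $\Sigma_{\min}(\mathbf A,\mathbf B)$) can be computed from the entries (lower and upper bounds) of $\mathbf A$ and $\mathbf B$ in a number of operations in $S$ that is polynomial in $n$ and $s$.
   Context: A semiring is a set $S$ with an associative commutative addition $\oplus$ and an associative multiplication $\odot$ that distributes over $\oplus$ on both sides; it is idempotent if $x\oplus x=x$ for all $x$. A unity is an element $\mathbf 1$ with $\mathbf 1\odot x=x\odot\mathbf 1=x$; a zero is an element $\mathbf 0\neq\mathbf 1$ with $\mathbf 0\oplus x=x$ and $\mathbf 0\odot x=x\odot\mathbf 0=\mathbf 0$. The canonical order is: $x\preccurlyeq y$ iff $x\oplus y=y$ (and $x\prec y$ iff $x\preccurlyeq y$, $x\ne y$). $\mathrm{Mat}_{mn}(S)$ is the set of $m\times n$ matrices over $S$, with entrywise sum $\oplus$, entrywise order $\preccurlyeq$, and product $(AB)_{ij}=\bigoplus_k a_{ik}\odot b_{kj}$. $E$ is the identity matrix ($\mathbf 1$ on the diagonal, $\mathbf 0$ elsewhere). Closed intervals are sets $[\underline{\mathbf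 x},\overline{\mathbf x}]=\{t:\underline{\mathbf x}\preccurlyeq t\preccurlyeq\overline{\mathbf x}\}$ with $\underline{\mathbf x}\preccurlyeq\overline{\mathbf x}$. $I(S)$ is the set of all closed intervals in $S$ with operations $\mathbf x\star\mathbf y=[\underline{\mathbf x}\star\underline{\mathbf y},\overline{\mathbf x}\star\overline{\mathbf y}]$, $\star\in\{\oplus,\odot\}$ (infinite sums also taken bound by bound). The strong interval extension is $\mathcal I(S)=\{\mathbf x\in I(S):\mathbf 0\prec\underline{\mathbf x}\preccurlyeq\overline{\mathbf x}\}\cup\{[\mathbf 0,\mathbf 0]\}$ with the same operations; it is well-defined if it is closed under them. An interval matrix $\mathbf A$ is identified with the interval $[\underline{\mathbf A},\overline{\mathbf A}]$ of matrices between its matrix of lower bounds and its matrix of upper bounds; $A\in\mathbf A$ means $\underline{\mathbf A}\preccurlyeq A\preccurlyeq\overline{\mathbf A}$. The closure is $A^*=\bigoplus_{k\ge0}A^k=E\oplus A\oplus A^2\oplus\cdots$ for square matrices and $x^*=\mathbf 1\oplus x\oplus x^2\oplus\cdots$ for $x\in S$; whenever $*$ is applied, the infinite sum is assumed to be well-defined, i.e. the supremum exists and multiplication distributes over it, so that $A^*=AA^*\oplus E$ and $A^*B$ is the least solution of $X=AX\oplus B$. For an interval matrix, $\mathbf A^*=[\underline{\mathbf A}^*,\overline{\mathbf A}^*]$, so $\mathbf A^*\mathbf B=[\underline{\mathbf A}^*\underline{\mathbf B},\overline{\mathbf A}^*\overline{\mathbf B}]$. $\Sigma_{\min}(\mathbf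 A,\mathbf B)=\{A^*B:A\in\mathbf A,\ B\in\mathbf B\}$. Operations in $S$ are counted at unit cost: $\oplus$, $\odot$, and the closure $x\mapsto x^*$ of elements of $S$. *)

(* Defs.v *)
From mathcomp Require Import all_boot all_order all_algebra.

Set Implicit Arguments.
Unset Strict Implicit.
Unset Printing Implicit Defensive.

Import GRing.Theory.
Local Open Scope ring_scope.

(* [nzSemiRingType] provides the semiring with zero and unity, 0 != 1. *)
Definition idempotent_semiring (S : nzSemiRingType) : Prop :=
  forall x : S, x + x = x.

Definition canle (S : nzSemiRingType) (x y : S) : Prop := x + y = y.
Definition canlt (S : nzSemiRingType) (x y : S) : Prop := canle x y /\ x <> y.

Definition mxle (S : nzSemiRingType) (m n : nat) (X Y : 'M[S]_(m, n)) : Prop :=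
  forall i j, canle (X i j) (Y i j).

(* An interval is the pair of its bounds.  The operations on intervals act
   bound by bound, so they are those of the product semiring S * S, and the
   matrix product [A *m B] over S * S is the bound-by-bound matrix product. *)
Definition strong_itv (S : nzSemiRingType) (x : S * S) : Prop :=
  (canlt 0 x.1 /\ canle x.1 x.2) \/ x = (0, 0).

Definition strong_well_defined (S : nzSemiRingType) : Prop :=
  forall x y : S * S, strong_itv x -> strong_itv y ->
    strong_itv (x + y) /\ strong_itv (x * y).

Definition strong_imx (S : nzSemiRingType) (m n : nat)
    (A : 'M[S * S]_(m, n)) : Prop :=
  forall i j, strong_itv (A i j).

Definition lowmx (S : nzSemiRingType) (m n : nat) (A : 'M[S * S]_(m, n)) :
  'M[S]_(m, n) := map_mx fst A.
Definition upmx (S : nzSemiRingType) (m n : nat) (A : 'M[S * S]_(m, n)) :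
  'M[S]_(m, n) := map_mx snd A.

Definition in_imx (S : nzSemiRingType) (m n : nat)
    (A : 'M[S * S]_(m, n)) (X : 'M[S]_(m, n)) : Prop :=
  mxle (lowmx A) X /\ mxle X (upmx A).

Definition is_sup (T : Type) (le : T -> T -> Prop) (u : nat -> T) (v : T) :
  Prop := (forall k, le (u k) v) /\ (forall w, (forall k, le (u k) w) -> le v w).

(* [y] is the well-defined closure of [x]: the supremum of the partial sums
   1 + x + ... + x^k, over which multiplication distributes on both sides. *)
Definition is_closure (S : nzSemiRingType) (x y : S) : Prop :=
  let u := fun k => \sum_(i < k.+1) x ^+ i in
  [/\ is_sup (@canle S) u y,
      forall c, is_sup (@canle S) (fun k => c * u k) (c * y) &
      forall c, is_sup (@canle S) (fun k => u k * c) (y * c)].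

Definition is_mxclosure (S : nzSemiRingType) (n : nat) (X Y : 'M[S]_n) : Prop :=
  let u := fun k => \sum_(i < k.+1) X ^+ i in
  [/\ is_sup (@mxle S n n) u Y,
      forall m (C : 'M[S]_(m, n)),
        is_sup (@mxle S m n) (fun k => C *m u k) (C *m Y) &
      forall m (C : 'M[S]_(n, m)),
        is_sup (@mxle S n m) (fun k => u k *m C) (Y *m C)].

Definition is_imxclosure (S : nzSemiRingType) (n : nat)
    (A As : 'M[S * S]_n) : Prop :=
  is_mxclosure (lowmx A) (lowmx As) /\ is_mxclosure (upmx A) (upmx As).

Definition Sigma_min (S : nzSemiRingType) (n s : nat)
    (A : 'M[S * S]_n) (B : 'M[S * S]_(n, s)) (Z : 'M[S]_(n, s)) : Prop :=
  exists X Xs Y, [/\ in_imx A X, is_mxclosure X Xs, in_imx B Y & Z = Xs *m Y].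

(* [C] is the least (for inclusion) closed interval of matrices containing
   [Sigma]. *)
Definition least_interval (S : nzSemiRingType) (m n : nat)
    (C : 'M[S * S]_(m, n)) (Sigma : 'M[S]_(m, n) -> Prop) : Prop :=
  [/\ mxle (lowmx C) (upmx C),
      forall Z, Sigma Z -> in_imx C Z &
      forall D : 'M[S * S]_(m, n), mxle (lowmx D) (upmx D) ->
        (forall Z, Sigma Z -> in_imx D Z) ->
        forall Z, in_imx C Z -> in_imx D Z].

(* Straight-line programs over the operations +, *, closure.  [Reg k] is the
   result of the [k]-th instruction; an undefined register reads as 0.
   [I] indexes the inputs and [O] the outputs. *)
Inductive operand (I : Type) : Type :=
  | Zero
  | One
  | Inp of I
  | Reg of nat.
Arguments Zero {I}.
Arguments One {I}.
Arguments Reg {I} _.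

Inductive instr (I : Type) : Type :=
  | Add of operand I & operand I
  | Mul of operand I & operand I
  | Star of operand I.

Record program (I O : Type) : Type := Program {
  code : seq (instr I);
  result : O -> operand I
}.

(* Every instruction performs exactly one semiring operation. *)
Definition cost (I O : Type) (P : program I O) : nat := size (code P).

Definition value (S : nzSemiRingType) (I : Type) (inp : I -> S) (mem : seq S)
    (o : operand I) : S :=
  match o with
  | Zero => 0
  | One => 1
  | Inp i => inp i
  | Reg k => nth 0 mem k
  end.

Definition step (S : nzSemiRingType) (I : Type) (inp : I -> S) (mem : seq S)
    (c : instr I) (v : S) : Prop :=
  match c with
  | Add o1 o2 => v = value inp mem o1 + value inp mem o2
  | Mul o1 o2 => v = value inp mem o1 * value inp mem o2
  | Star o => is_closure (value inp mem o) v
  end.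

(* [run inp c mem]: every closure taken by [c] on the input [inp] is
   well-defined and the successive results are [mem]. *)
Inductive run (S : nzSemiRingType) (I : Type) (inp : I -> S) :
    seq (instr I) -> seq S -> Prop :=
  | run_nil : run inp [::] [::]
  | run_rcons p mem c v :
      run inp p mem -> step inp mem c v -> run inp (rcons p c) (rcons mem v).

(* The program can be executed: each closure it takes is well-defined. *)
Definition executable (S : nzSemiRingType) (I O : Type) (P : program I O)
    (inp : I -> S) : Prop :=
  exists mem, run inp (code P) mem.

Definition computes (S : nzSemiRingType) (I O : Type) (P : program I O)
    (inp : I -> S) (out : O -> S) : Prop :=
  exists2 mem, run inp (code P) mem &
    forall o, value inp mem (result P o) = out o.

Inductive bound := Lower | Upper.

Definition get_bound (T : Type) (b : bound) (x : T * T) : T :=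
  match b with Lower => x.1 | Upper => x.2 end.

Inductive input (n s : nat) : Type :=
  | EntryA of bound & 'I_n & 'I_n
  | EntryB of bound & 'I_n & 'I_s.

Definition input_val (S : nzSemiRingType) (n s : nat)
    (A : 'M[S * S]_n) (B : 'M[S * S]_(n, s)) (x : input n s) : S :=
  match x with
  | EntryA b i j => get_bound b (A i j)
  | EntryB b i j => get_bound b (B i j)
  end.

Inductive output (n s : nat) : Type :=
  | EntryC of bound & 'I_n & 'I_s.

Definition output_val (S : nzSemiRingType) (n s : nat)
    (C : 'M[S * S]_(n, s)) (x : output n s) : S :=
  match x with EntryC b i j => get_bound b (C i j) end.

(* Main.v *)
Require Import Defs.
From mathcomp Require Import all_boot all_order all_algebra.

Set Implicit Arguments.
Unset Strict Implicit.
Unset Printing Implicit Defensive.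

Import GRing.Theory.
Local Open Scope ring_scope.

(** Multiplication and closure of matrices are monotone, so the extreme points
    of the united minimal solution set are attained at the bounds: the lower
    bound of the interval product is the closure of the lower bound of A times
    the lower bound of B, it belongs to the solution set, and likewise above
    ([closure_intervalP]).  It remains to compute two products A^*B over S, one
    per bound.

    This is done by Gauss-Jordan elimination on the n x (n + s) tableau [A | B]:
    pivoting at k replaces every entry M_ic by M_ic + M_ik (M_kk)^* M_kc, and
    takes a single closure.  Elimination is correct because the tableau stays
    squeezed between two bounds ([eliminated]).  It never exceeds
    [A^* | A^*B]: since A^* A^* <= A^* and 1 <= A^*, a diagonal entry of A^*
    dominates the closure of every element that it dominates.  It dominates
    [A | B], and after pivoting at l it is stable under left multiplication by
    column l of A; after all pivots the right block X satisfies A X <= X and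
    B <= X, so that A^*B <= X because A^*B is the least such X.

    The upper invariant also shows that the powers of every pivot are dominated
    by a diagonal entry of the closure of the upper bound of A, which is why
    the program can be executed as soon as such elements have closures.

    Programs are assembled from combinators whose semantics is relational:
    sequential composition of programs is composition of the input-output
    relations [computes] ([computes_seqp]).  The partiality of the closure is
    then part of the relation, and the existence of a run and the correctness of
    all runs are both read off from it.  The cost is exactly
    2n(1 + (n + s) + 2n(n + s)). *)

(** * Canonical order and closures *)

Lemma partial_sumS (R : pzSemiRingType) (x : R) (k : nat) :
  \sum_(i < k.+2) x ^+ i = 1 + x * \sum_(i < k.+1) x ^+ i.
Proof.
rewrite big_ord_recl expr0 mulr_sumr; congr (_ + _).
by apply: eq_bigr => i _; rewrite exprS.
Qed.

Lemma lowmx_mul (S : nzSemiRingType) (m n p : nat)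
    (A : 'M[S * S]_(m, n)) (B : 'M[S * S]_(n, p)) :
  lowmx (A *m B) = lowmx A *m lowmx B.
Proof. exact: map_mxM. Qed.

Lemma upmx_mul (S : nzSemiRingType) (m n p : nat)
    (A : 'M[S * S]_(m, n)) (B : 'M[S * S]_(n, p)) :
  upmx (A *m B) = upmx A *m upmx B.
Proof. exact: map_mxM. Qed.

Section CanonicalOrder.

Variable S : nzSemiRingType.
Hypothesis Sid : idempotent_semiring S.
Local Notation "x <~ y" := (canle x y) (at level 70).

Lemma canle_refl (x : S) : x <~ x.
Proof. exact: Sid. Qed.

Lemma canle_trans (y x z : S) : x <~ y -> y <~ z -> x <~ z.
Proof. by rewrite /canle => xy yz; rewrite -yz addrA xy. Qed.

Lemma canle_anti (x y : S) : x <~ y -> y <~ x -> x = y.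
Proof. by rewrite /canle addrC => -> . Qed.

Lemma canle_add (x y z : S) : x <~ z -> y <~ z -> x + y <~ z.
Proof. by rewrite /canle -addrA => xz ->. Qed.

Lemma canle_addl (x y : S) : x <~ x + y.
Proof. by rewrite /canle addrA Sid. Qed.

Lemma canle_addr (x y : S) : y <~ x + y.
Proof. by rewrite addrC; exact: canle_addl. Qed.

Lemma canle_mul (x x' y y' : S) : x <~ x' -> y <~ y' -> x * y <~ x' * y'.
Proof.
move=> xx yy; apply: (@canle_trans (x' * y)).
  by rewrite /canle -mulrDl xx.
by rewrite /canle -mulrDr yy.
Qed.

Lemma canle_sum (I : Type) (r : seq I) (F : I -> S) (z : S) :
  (forall i, F i <~ z) -> \sum_(i <- r) F i <~ z.
Proof.
move=> Fz; apply: (big_rec (fun x => x <~ z)) => [|i x _ xz].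
  by rewrite /canle add0r.
exact: canle_add.
Qed.

Lemma canle_term (I : finType) (F : I -> S) (i : I) : F i <~ \sum_j F j.
Proof. by rewrite (bigD1 i) //=; exact: canle_addl. Qed.

(** Diagonal entries of a closure matrix are such elements a, so that they bound
    all powers of what they dominate. *)
Lemma canle_pow (x a : S) : 1 <~ a -> a * a <~ a -> x <~ a ->
  forall k, x ^+ k <~ a.
Proof.
move=> a1 aa xa; elim=> [|k IHk]; first by rewrite expr0.
by rewrite exprS; apply: canle_trans (canle_mul xa IHk) aa.
Qed.

Lemma mxleP (m n : nat) (X Y : 'M[S]_(m, n)) : mxle X Y <-> X + Y = Y.
Proof.
split=> [XY | XY i j]; first by apply/matrixP=> i j; rewrite mxE XY.
by rewrite /canle -{2}XY mxE.
Qed.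

Lemma mxle_refl (m n : nat) (X : 'M[S]_(m, n)) : mxle X X.
Proof. by move=> i j; exact: canle_refl. Qed.

Lemma mxle_trans (m n : nat) (Y X Z : 'M[S]_(m, n)) :
  mxle X Y -> mxle Y Z -> mxle X Z.
Proof. by move=> XY YZ i j; apply: canle_trans (XY i j) (YZ i j). Qed.

Lemma mxle_mul (m n p : nat) (X X' : 'M[S]_(m, n)) (Y Y' : 'M[S]_(n, p)) :
  mxle X X' -> mxle Y Y' -> mxle (X *m Y) (X' *m Y').
Proof.
move=> /mxleP XX /mxleP YY; apply: (@mxle_trans _ _ (X' *m Y)); apply/mxleP.
  by rewrite -mulmxDl XX.
by rewrite -mulmxDr YY.
Qed.

(** An idempotent sum is the least upper bound of its terms, so bounding a
    matrix product amounts to bounding each term of each entry. *)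
Lemma mxle_entry (m n p : nat) (X : 'M[S]_(m, n)) (Y : 'M[S]_(n, p))
    (Z : 'M[S]_(m, p)) :
  mxle (X *m Y) Z <-> forall i l j, X i l * Y l j <~ Z i j.
Proof.
split=> [XYZ i l j | XYZ i j]; last by rewrite mxE; apply: canle_sum.
apply: canle_trans (XYZ i j); rewrite mxE.
exact: (canle_term (fun l => X i l * Y l j)).
Qed.

Section ScalarClosure.

Variables x y : S.
Hypothesis xy : is_closure x y.

Lemma closure_ge1 : 1 <~ y.
Proof. by case: xy => [[/(_ 0%N)]]; rewrite big_ord1 expr0. Qed.

(** Multiplying the partial sums by x shifts them, and multiplication by x
    preserves their supremum. *)
Lemma closure_unfold : x * y <~ y.
Proof.
case: xy => [[ub _] /(_ x)[_ lub] _]; apply: lub => k.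
by apply: canle_trans (ub k.+1); rewrite partial_sumS; exact: canle_addr.
Qed.

Lemma closure_le (a : S) : 1 <~ a -> a * a <~ a -> x <~ a -> y <~ a.
Proof.
move=> a1 aa xa; case: xy => [[_ lub] _ _]; apply: lub => k.
by apply: canle_sum => i; exact: canle_pow.
Qed.

End ScalarClosure.

Section MatrixClosure.

Variables (n : nat) (A As : 'M[S]_n).
Hypothesis AAs : is_mxclosure A As.

Lemma mxclosure_ge1 : mxle 1%:M As.
Proof. by case: AAs => [[/(_ 0%N)]]; rewrite big_ord1 expr0. Qed.

Lemma mxclosure_unfold : mxle (A *m As) As.
Proof.
case: AAs => [[ub _] /(_ n A)[_ lub] _]; apply: lub => k.
apply: mxle_trans (ub k.+1); rewrite partial_sumS => i j.
by rewrite [in X in _ <~ X]mxE; exact: canle_addr.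
Qed.

(** The partial sums of the closure, applied to B, stay below X by induction;
    right multiplication by B preserves their supremum.  Idempotence and
    monotonicity of the closure are the cases where X is the closure itself or
    that of a larger matrix. *)
Lemma mxclosure_least (m : nat) (B X : 'M[S]_(n, m)) :
  mxle (A *m X) X -> mxle B X -> mxle (As *m B) X.
Proof.
move=> AX BX; case: AAs => [_ _ /(_ m B)[_ lub]]; apply: lub.
elim=> [|k IHk]; first by rewrite big_ord1 expr0 mul1mx.
rewrite partial_sumS mulmxDl mul1mx -mulmxA => i j.
rewrite mxE; apply: canle_add (BX i j) _.
exact: (mxle_trans (mxle_mul (@mxle_refl _ _ A) IHk) AX).
Qed.

Lemma mxclosure_ge : mxle A As.
Proof.
apply: mxle_trans mxclosure_unfold; rewrite -{1}[A]mulmx1.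
exact: mxle_mul (@mxle_refl _ _ _) mxclosure_ge1.
Qed.

Lemma mxclosure_idem : mxle (As *m As) As.
Proof. exact: mxclosure_least mxclosure_unfold (@mxle_refl _ _ _). Qed.

End MatrixClosure.

Lemma mxclosure_mono (n : nat) (A A' As As' : 'M[S]_n) :
  is_mxclosure A As -> is_mxclosure A' As' -> mxle A A' -> mxle As As'.
Proof.
move=> cA cA' AA'; rewrite -[As]mulmx1.
apply: (mxclosure_least cA) (mxclosure_ge1 cA').
apply: mxle_trans (mxclosure_unfold cA').
exact: mxle_mul AA' (@mxle_refl _ _ _).
Qed.

(** Both bounds of As *m B are themselves elements of the solution set, so any
    interval that contains the set contains them. *)
Lemma closure_intervalP (n s : nat) (A As : 'M[S * S]_n) (B : 'M[S * S]_(n, s)) :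
  mxle (lowmx A) (upmx A) -> mxle (lowmx B) (upmx B) -> is_imxclosure A As ->
  least_interval (As *m B) (Sigma_min A B).
Proof.
move=> leA leB [cl cu].
have inA : in_imx A (lowmx A) /\ in_imx A (upmx A).
  by do 2!split=> //; exact: mxle_refl.
have inB : in_imx B (lowmx B) /\ in_imx B (upmx B).
  by do 2!split=> //; exact: mxle_refl.
split.
- rewrite lowmx_mul upmx_mul.
  exact: mxle_mul (mxclosure_mono cl cu leA) leB.
- move=> _ [X [Xs [Y [[lX Xu] cX [lY Yu] ->]]]].
  split; rewrite ?lowmx_mul ?upmx_mul.
    exact: mxle_mul (mxclosure_mono cl cX lX) lY.
  exact: mxle_mul (mxclosure_mono cX cu Xu) Yu.
move=> D leD SD Z [lZ Zu].
have [Dl _] : in_imx D (lowmx As *m lowmx B).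
  by apply: SD; exists (lowmx A), (lowmx As), (lowmx B); case: inA; case: inB.
have [_ uD] : in_imx D (upmx As *m upmx B).
  by apply: SD; exists (upmx A), (upmx As), (upmx B); case: inA; case: inB.
split; first by apply: mxle_trans lZ; rewrite lowmx_mul.
by apply: mxle_trans Zu _; rewrite upmx_mul.
Qed.

End CanonicalOrder.

(** * Gauss-Jordan elimination *)

Definition tableau (n s : nat) : Type := ('I_n * ('I_n + 'I_s))%type.

Definition augment (S : nzSemiRingType) (n s : nat)
    (A : 'M[S]_n) (B : 'M[S]_(n, s)) (x : tableau n s) : S :=
  match x.2 with inl j => A x.1 j | inr j => B x.1 j end.

(** A relation and not a function, since the pivot may have no closure. *)
Definition pivot_rel (S : nzSemiRingType) (n s : nat) (k : 'I_n)
    (M M' : tableau n s -> S) : Prop :=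
  exists2 y, is_closure (M (k, inl k)) y &
    forall i c, M' (i, c) = M (i, c) + M (i, inl k) * (y * M (k, c)).

Section Elimination.

Variables (S : nzSemiRingType) (n s : nat).
Hypothesis Sid : idempotent_semiring S.
Variables (A As : 'M[S]_n) (B : 'M[S]_(n, s)).
Hypothesis AAs : is_mxclosure A As.
Local Notation "x <~ y" := (canle x y) (at level 70).
Local Notation G := (augment A B).
Local Notation N := (augment As (As *m B)).

(** In terms of paths: the entries of M account at least for the single arcs and
    for prefixing an arc to a path through an eliminated vertex, and at most for
    all paths. *)
Definition eliminated (ks : seq 'I_n) (M : tableau n s -> S) : Prop :=
  [/\ forall x, G x <~ M x,
      forall i l c, l \in ks -> A i l * M (l, c) <~ M (i, c) &
      forall x, M x <~ N x].

Lemma closure_mul_bound (i k : 'I_n) (c : 'I_n + 'I_s) :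
  As i k * N (k, c) <~ N (i, c).
Proof.
have idem := mxclosure_idem Sid AAs.
case: c => j; rewrite /augment /=; first exact: (iffLR (mxle_entry Sid _ _ _) idem).
apply: (iffLR (mxle_entry Sid _ _ _)); rewrite mulmxA.
exact: mxle_mul idem (mxle_refl Sid _).
Qed.

Lemma closure_diag_ge1 (k : 'I_n) : 1 <~ As k k.
Proof. by have := mxclosure_ge1 AAs k k; rewrite mxE eqxx. Qed.

Lemma eliminated_nil (M : tableau n s -> S) :
  (forall x, G x = M x) -> eliminated [::] M.
Proof.
move=> GM; split=> // [x | x]; rewrite -GM; first exact: canle_refl.
case: x => i [j | j] /=; rewrite /augment /=; first exact: (mxclosure_ge Sid AAs).
by have := mxle_mul (mxclosure_ge1 AAs) (mxle_refl Sid B) i j; rewrite mul1mx.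
Qed.

(** For the new pivot k itself, the stability A_ik M'_kc <= M'_ic comes from
    1 <= y and M_kk y <= y, where y is the closure of M_kk: both terms of M'_kc
    are of the form t M_kc with t <= y. *)
Lemma eliminated_rcons (ks : seq 'I_n) (k : 'I_n) (M M' : tableau n s -> S) :
  eliminated ks M -> pivot_rel k M M' -> eliminated (rcons ks k) M'.
Proof.
case=> GM AM MN [y cy M'E].
have MM' x : M x <~ M' x by case: x => i c; rewrite M'E; exact: canle_addl.
have pivM' i c : M (i, inl k) * (y * M (k, c)) <~ M' (i, c).
  by rewrite M'E; exact: canle_addr.
split=> [x | i l c | [i c]].
- exact: (canle_trans (GM x)).
- rewrite mem_rcons inE [M' (l, c)]M'E mulrDr => /orP[/eqP-> | lks]; last first.
    apply: canle_add; first exact: (canle_trans (AM _ _ _ lks)).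
    rewrite mulrA; apply: canle_trans (pivM' i c).
    exact: (canle_mul (AM _ _ _ lks) (canle_refl Sid _)).
  have AkM : A i k <~ M (i, inl k) := GM (i, inl k).
  have step t : t <~ y -> A i k * (t * M (k, c)) <~ M' (i, c).
    move=> ty; apply: canle_trans (pivM' i c); apply: canle_mul => //.
    by apply: canle_mul => //; exact: canle_refl.
  apply: canle_add; first by rewrite -[M (k, c)]mul1r; exact: step (closure_ge1 cy).
  by rewrite [M (k, inl k) * _]mulrA; exact: step (closure_unfold Sid cy).
(* The upper bound: As k k dominates M_kk, hence its closure y. *)
rewrite M'E; apply: canle_add; first exact: MN.
have yAs : y <~ As k k.
  apply: (closure_le cy (closure_diag_ge1 k)); last exact: MN.
  exact: (closure_mul_bound k k (inl k)).
apply: canle_trans (closure_mul_bound i k c).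
apply: (canle_mul (MN (i, inl k))).
apply: canle_trans (closure_mul_bound k k c).
exact: canle_mul.
Qed.

Lemma eliminated_all (ks : seq 'I_n) (M : tableau n s -> S) :
  (forall l, l \in ks) -> eliminated ks M ->
  forall i j, M (i, inr j) = (As *m B) i j.
Proof.
move=> all_ks [GM AM MN] i j; apply: canle_anti; first exact: (MN (i, inr j)).
pose X : 'M[S]_(n, s) := \matrix_(i, j) M (i, inr j).
suff: mxle (As *m B) X by move/(_ i j); rewrite [X in _ <~ X]mxE.
apply: (mxclosure_least Sid AAs) => [|i' j']; last first.
  by rewrite [X in _ <~ X]mxE; exact: (GM (i', inr j')).
by apply/mxle_entry => // i' l j'; rewrite !mxE; exact: AM.
Qed.

End Elimination.

(** * Combinators for straight-line programs *)

Section Programs.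

Variables (I J O : Type).

(** A register that P leaves undefined reads as 0 in P, but would be defined by
    the code placed after P; it is therefore replaced by [Zero]. *)
Definition restrict_regs (k : nat) (o : operand I) : operand I :=
  match o with Reg r => if (r < k)%N then o else Zero | _ => o end.

Definition link_operand (P : program I J) (o : operand J) : operand I :=
  match o with
  | Zero => Zero
  | One => One
  | Inp x => restrict_regs (size (code P)) (result P x)
  | Reg r => Reg (size (code P) + r)
  end.

Definition link_instr (P : program I J) (c : instr J) : instr I :=
  match c with
  | Add o1 o2 => Add (link_operand P o1) (link_operand P o2)
  | Mul o1 o2 => Mul (link_operand P o1) (link_operand P o2)
  | Star o => Star (link_operand P o)
  end.

Definition seqp (P : program I J) (Q : program J O) : program I O :=
  Program (code P ++ map (link_instr P) (code Q))
          (fun o => link_operand P (result Q o)).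

Definition wire (g : O -> I) : program I O := Program [::] (fun o => Inp (g o)).

(** Keeps the inputs available to the programs that come next. *)
Definition carry (P : program I O) : program I (I + O) :=
  Program (code P)
          (fun x => match x with inl i => Inp i | inr o => result P o end).

End Programs.

(** One instruction for each output; the instructions are meant to read inputs
    only, so that their order is irrelevant. *)
Definition layer (I : Type) (O : finType) (f : O -> instr I) : program I O :=
  Program (map f (enum O)) (fun o => Reg (index o (enum O))).

Section Semantics.

Variable S : nzSemiRingType.

Lemma run_size (I : Type) (inp : I -> S) p mem :
  run inp p mem -> size mem = size p.
Proof. by elim=> // {}p {}mem c v _ IH _; rewrite !size_rcons IH. Qed.

Lemma run_nilE (I : Type) (inp : I -> S) mem : run inp [::] mem -> mem = [::].
Proof. by move/run_size/size0nil. Qed.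

Lemma run_rconsE (I : Type) (inp : I -> S) p c mem :
  run inp (rcons p c) mem ->
  exists mem' v, [/\ mem = rcons mem' v, run inp p mem' & step inp mem' c v].
Proof.
move E: (rcons p c) => q r; case: r E => [|p' mem' c' v r st].
  by move/(congr1 size); rewrite size_rcons.
by move/rcons_inj => [-> ->]; exists mem', v.
Qed.

Lemma eq_run (I : Type) (inp inp' : I -> S) p mem :
  inp =1 inp' -> run inp p mem -> run inp' p mem.
Proof.
move=> e; have eV m o : value inp m o = value inp' m o by case: o => //=.
elim=> [|{}p {}mem c v _ IH st]; first exact: run_nil.
by apply: run_rcons IH _; case: c st => /= [o1 o2|o1 o2|o]; rewrite !eV.
Qed.

Lemma eq_computes (I O : Type) (P : program I O) (inp inp' : I -> S)
    (out : O -> S) :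
  inp =1 inp' -> computes P inp out -> computes P inp' out.
Proof.
move=> e [mem r outE]; exists mem; first exact: eq_run r.
by move=> o; rewrite -outE; case: (result P o) => //= x; rewrite e.
Qed.

Lemma value_link (I J : Type) (inp : I -> S) (P : program I J) m1 m2 o :
  size m1 = size (code P) ->
  value inp (m1 ++ m2) (link_operand P o) =
  value (fun x => value inp m1 (result P x)) m2 o.
Proof.
move=> s1; case: o => //= [x | r]; last first.
  by rewrite nth_cat -s1 ltnNge leq_addr /= addKn.
case: (result P x) => //= r; rewrite -s1; case: ltnP => /= r1.
  by rewrite nth_cat r1.
by rewrite nth_default.
Qed.

(** Running the linked code amounts to running P, and then the other code on the
    results of P. *)
Lemma run_link (I J : Type) (inp : I -> S) (P : program I J) q mem :
  run inp (code P ++ map (link_instr P) q) mem <->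
  exists m1 m2, [/\ mem = m1 ++ m2, run inp (code P) m1 &
                    run (fun x => value inp m1 (result P x)) q m2].
Proof.
have stepE m1 m2 c v : size m1 = size (code P) ->
    step inp (m1 ++ m2) (link_instr P c) v <->
    step (fun x => value inp m1 (result P x)) m2 c v.
  by move=> s1; case: c => [o1 o2|o1 o2|o] /=; rewrite !value_link.
elim/last_ind: q mem => [|q c IHq] mem.
  rewrite cats0; split=> [r | [m1 [m2 [-> r /run_nilE ->]]]]; last by rewrite cats0.
  by exists mem, [::]; rewrite cats0; split=> //; exact: run_nil.
rewrite map_rcons -rcons_cat; split.
  move=> /run_rconsE[m [v [-> /IHq[m1 [m2 [-> r1 r2]]] st]]].
  exists m1, (rcons m2 v); rewrite rcons_cat; split=> //.
  by apply: run_rcons r2 _; apply/stepE => //; exact: run_size r1.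
case=> m1 [m [-> r1 /run_rconsE[m2 [v [-> r2 st]]]]].
rewrite -rcons_cat; apply: run_rcons; first by apply/IHq; exists m1, m2.
by apply/stepE => //; exact: run_size r1.
Qed.

(** Also accounts for closures that do not exist: both sides fail when no run of
    P leaves Q executable. *)
Lemma computes_seqp (I J O : Type) (P : program I J) (Q : program J O)
    (inp : I -> S) (out : O -> S) :
  computes (seqp P Q) inp out <->
  exists2 mid, computes P inp mid & computes Q mid out.
Proof.
split=> [[mem /run_link[m1 [m2 [-> r1 r2]]] outE] | [mid [m1 r1 midE] cQ]].
  exists (fun x => value inp m1 (result P x)); first by exists m1.
  by exists m2 => // o; rewrite -outE value_link //; exact: run_size r1.
have [m2 r2 outE] := eq_computes (fun x => esym (midE x)) cQ.
exists (m1 ++ m2); first by apply/run_link; exists m1, m2.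
by move=> o; rewrite /= value_link //; exact: run_size r1.
Qed.

Lemma computes_wire (I O : Type) (g : O -> I) (inp : I -> S) (out : O -> S) :
  computes (wire g) inp out <-> forall o, inp (g o) = out o.
Proof.
split=> [[mem _ outE] o | outE]; first by rewrite -outE.
by exists [::] => //; exact: run_nil.
Qed.

Lemma computes_wire_seqp (I J O : Type) (g : J -> I) (P : program J O)
    (inp : I -> S) (out : O -> S) :
  computes (seqp (wire g) P) inp out <-> computes P (fun x => inp (g x)) out.
Proof.
split=> [/computes_seqp[mid /computes_wire midE] | cP].
  by apply: eq_computes => x; rewrite midE.
by apply/computes_seqp; exists (fun x => inp (g x)) => //; apply/computes_wire.
Qed.

Lemma computes_carry (I O : Type) (P : program I O) (inp : I -> S)
    (out : I + O -> S) :
  computes (carry P) inp out <->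
  (forall i, inp i = out (inl i)) /\ computes P inp (fun o => out (inr o)).
Proof.
split=> [[mem r outE] | [inE [mem r outE]]].
  split=> [i|]; first exact: (outE (inl i)).
  by exists mem => // o; exact: (outE (inr o)).
by exists mem => // [[i | o]] /=.
Qed.

(** The hypothesis holds for instructions that read inputs and constants only. *)
Lemma computes_layer (I : Type) (O : finType) (f : O -> instr I)
    (inp : I -> S) (out : O -> S) :
  (forall mem o v, step inp mem (f o) v <-> step inp [::] (f o) v) ->
  computes (layer f) inp out <-> forall o, step inp [::] (f o) (out o).
Proof.
move=> local; split=> [[mem r outE] o | st].
  have main os m : uniq os -> run inp (map f os) m -> o \in os ->
      step inp [::] (f o) (nth 0 m (index o os)).
    elim/last_ind: os m => // os o' IH m0.
    rewrite map_rcons rcons_uniq mem_rcons inE => /andP[o'os os_uniq].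
    move=> /run_rconsE[m [v [-> r' st]]].
    have sm : size m = size os by rewrite (run_size r') size_map.
    rewrite -[rcons os o']cats1 index_cat; case: ifP => [oos _ | _].
      by rewrite nth_rcons sm index_mem oos; exact: IH.
    rewrite orbF => /eqP->; rewrite nth_rcons sm /= eqxx addn0 ltnn eqxx.
    exact/(local m).
  by rewrite -outE; apply: main; rewrite ?enum_uniq ?mem_enum.
exists (map out (enum O)) => [/=|o /=].
  elim/last_ind: (enum O) => [|os o IH]; first exact: run_nil.
  by rewrite !map_rcons; apply: run_rcons IH _; apply/local.
by rewrite (nth_map o) ?index_mem ?mem_enum // nth_index ?mem_enum.
Qed.

Lemma executableE (I O : Type) (P : program I O) (inp : I -> S) :
  executable P inp <-> exists out, computes P inp out.
Proof.
split=> [[mem r] | [out [mem r _]]]; last by exists mem.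
by exists (fun o => value inp mem (result P o)), mem.
Qed.

End Semantics.

Lemma cost_seqp (I J O : Type) (P : program I J) (Q : program J O) :
  cost (seqp P Q) = (cost P + cost Q)%N.
Proof. by rewrite /cost size_cat size_map. Qed.

Lemma cost_layer (I : Type) (O : finType) (f : O -> instr I) :
  cost (layer f) = #|O|.
Proof. by rewrite /cost size_map cardE. Qed.

(** * The elimination program *)

Section GaussJordan.

Variables n s : nat.
Local Notation T := (tableau n s).
Local Notation C := ('I_n + 'I_s)%type.

Definition pivot_closure (k : 'I_n) : program T unit :=
  layer (fun _ : unit => Star (Inp ((k, inl k) : T))).

Definition scaled_row (k : 'I_n) : program (T + unit) C :=
  layer (fun c : C => Mul (Inp (inr tt)) (Inp (inl ((k, c) : T)))).

Definition row_multiples (k : 'I_n) : program (T + unit + C) T :=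
  layer (fun x : T => Mul (Inp (inl (inl (x.1, inl k)))) (Inp (inr x.2))).

Definition add_multiples : program (T + unit + C + T) T :=
  layer (fun x : T => Add (Inp (inl (inl (inl x)))) (Inp (inr x))).

(** The row of the pivot is scaled once, by n + s products, before it is
    multiplied by the entries of the pivot column. *)
Definition pivot (k : 'I_n) : program T T :=
  seqp (carry (pivot_closure k))
    (seqp (carry (scaled_row k)) (seqp (carry (row_multiples k)) add_multiples)).

Definition eliminate (ks : seq 'I_n) : program T T :=
  foldl (fun P k => seqp P (pivot k)) (wire id) ks.

Definition bound_entry (b : bound) (x : T) : input n s :=
  match x.2 with inl j => EntryA s b x.1 j | inr j => EntryB b x.1 j end.

Definition solve_bound (b : bound) : program (input n s) T :=
  seqp (wire (bound_entry b)) (eliminate (enum 'I_n)).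

Definition read_output (x : output n s) : input n s + T + T :=
  match x with
  | EntryC Lower i j => inl (inr (i, inr j))
  | EntryC Upper i j => inr (i, inr j)
  end.

Definition solve_interval : program (input n s) (output n s) :=
  seqp (carry (solve_bound Lower))
    (seqp (carry (seqp (wire inl) (solve_bound Upper))) (wire read_output)).

Lemma cost_pivot (k : 'I_n) :
  cost (pivot k) = (1 + (n + s) + n * (n + s) * 2)%N.
Proof.
rewrite /pivot !cost_seqp ![cost (carry _)]cost_layer [cost add_multiples]cost_layer.
by rewrite card_unit card_prod card_sum !card_ord muln2 -addnn !addnA.
Qed.

Lemma cost_solve_interval :
  cost solve_interval = (n * (1 + (n + s) + n * (n + s) * 2) * 2)%N.
Proof.
have costE ks :
    cost (eliminate ks) = (size ks * (1 + (n + s) + n * (n + s) * 2))%N.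
  elim/last_ind: ks => [|ks k IH]; first by rewrite mul0n.
  rewrite /eliminate foldl_rcons cost_seqp -/(eliminate ks) IH cost_pivot.
  by rewrite size_rcons mulSn addnC.
have costB b :
    cost (solve_bound b) = (n * (1 + (n + s) + n * (n + s) * 2))%N.
  by rewrite cost_seqp costE size_enum_ord.
rewrite /solve_interval !cost_seqp.
(* [carry] does not change the code, hence neither the cost. *)
rewrite -[cost (carry (solve_bound _))]/(cost (solve_bound Lower)).
rewrite -[cost (carry _)]/(cost (seqp (wire inl) (solve_bound Upper))).
by rewrite cost_seqp !costB /= add0n addn0 addnn -muln2.
Qed.

Section Correctness.

Variable S : nzSemiRingType.

Lemma computes_pivot (k : 'I_n) (M M' : T -> S) :
  computes (pivot k) M M' <-> pivot_rel k M M'.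
Proof.
rewrite /pivot; split.
  case/computes_seqp=> v1 /computes_carry[e1 /computes_layer c1].
  case/computes_seqp=> v2 /computes_carry[e2 /computes_layer c2].
  case/computes_seqp=> v3 /computes_carry[e3 /computes_layer c3] /computes_layer c4.
  exists (v1 (inr tt)); first exact: (c1 _ tt).
  move=> i c; rewrite (c4 _ (i, c)) //= -e3 -e2 -e1 c3 //= -e2 -e1.
  by rewrite c2 //= -e1.
case=> y cy M'E.
(* Conversely, the intermediate values are the closure of the pivot, the scaled
   row and its multiples, each stage keeping the previous values. *)
pose v1 (x : T + unit) := match x with inl t => M t | inr _ => y end.
pose v2 (x : T + unit + C) :=
  match x with inl t => v1 t | inr c => y * M (k, c) end.
pose v3 (x : T + unit + C + T) :=
  match x with inl t => v2 t | inr t => M (t.1, inl k) * (y * M (k, t.2)) end.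
apply/computes_seqp; exists v1.
  by apply/computes_carry; split=> //; apply/computes_layer.
apply/computes_seqp; exists v2.
  by apply/computes_carry; split=> //; apply/computes_layer.
apply/computes_seqp; exists v3.
  by apply/computes_carry; split=> //; apply/computes_layer.
by apply/computes_layer => // [[i c]] /=; rewrite M'E.
Qed.

Hypothesis Sid : idempotent_semiring S.
Variables (A As : 'M[S]_n) (B : 'M[S]_(n, s)).
Hypothesis AAs : is_mxclosure A As.

Lemma eliminate_sound (ks : seq 'I_n) (M : T -> S) :
  computes (eliminate ks) (augment A B) M -> eliminated A As B ks M.
Proof.
elim/last_ind: ks M => [|ks k IH] M.
  by move/computes_wire; exact: eliminated_nil.
rewrite /eliminate foldl_rcons => /computes_seqp[M0 /IH inv /computes_pivot].
exact: eliminated_rcons.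
Qed.

(** The upper bound of [eliminated] puts the next pivot below a diagonal entry
    of As, so its closure exists and the elimination can go on. *)
Lemma eliminate_total (ks : seq 'I_n) :
  (forall (x : S) (i : 'I_n),
     (forall k, canle (x ^+ k) (As i i)) -> exists y, is_closure x y) ->
  exists M, computes (eliminate ks) (augment A B) M.
Proof.
move=> clo; elim/last_ind: ks => [|ks k [M cM]].
  by exists (augment A B); apply/computes_wire.
have [_ _ MN] := eliminate_sound cM.
have [|y cy] := clo (M (k, inl k)) k.
  apply: (canle_pow (closure_diag_ge1 AAs k) _ (MN (k, inl k))).
  exact: (closure_mul_bound Sid B AAs k k (inl k)).
exists (fun x => M x + M (x.1, inl k) * (y * M (k, x.2))).
rewrite /eliminate foldl_rcons; apply/computes_seqp; exists M => //.
by apply/computes_pivot; exists y.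
Qed.

End Correctness.

Lemma computes_solve_bound (S : nzSemiRingType) (b : bound)
    (A : 'M[S * S]_n) (B : 'M[S * S]_(n, s)) (M : T -> S) :
  computes (solve_bound b) (input_val A B) M <->
  computes (eliminate (enum 'I_n))
    (augment (map_mx (get_bound b) A) (map_mx (get_bound b) B)) M.
Proof.
have entryE x : input_val A B (bound_entry b x) =
    augment (map_mx (get_bound b) A) (map_mx (get_bound b) B) x.
  by case: x => i [j|j]; rewrite /augment /= mxE.
split=> [/computes_wire_seqp | cM]; first exact: eq_computes.
by apply/computes_wire_seqp; apply: eq_computes cM.
Qed.

Lemma solve_bound_sound (S : nzSemiRingType) (b : bound)
    (A : 'M[S * S]_n) (Bs : 'M[S]_n) (B : 'M[S * S]_(n, s)) (M : T -> S) :
  idempotent_semiring S -> is_mxclosure (map_mx (get_bound b) A) Bs ->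
  computes (solve_bound b) (input_val A B) M ->
  forall i j, M (i, inr j) = (Bs *m map_mx (get_bound b) B) i j.
Proof.
move=> Sid cA /computes_solve_bound /(eliminate_sound Sid cA).
by apply: eliminated_all => // l; rewrite mem_enum.
Qed.

Lemma computes_solve_interval (S : nzSemiRingType)
    (inp : input n s -> S) (out : output n s -> S) :
  computes solve_interval inp out <->
  exists2 L, computes (solve_bound Lower) inp L &
  exists2 U, computes (solve_bound Upper) inp U &
    forall i j, L (i, inr j) = out (EntryC Lower i j) /\
                U (i, inr j) = out (EntryC Upper i j).
Proof.
split.
  case/computes_seqp=> v1 /computes_carry[e1 cL].
  case/computes_seqp=> v2 /computes_carry[e2 /computes_wire_seqp cU].
  move=> /computes_wire outE; exists (fun x => v1 (inr x)) => //.
  exists (fun x => v2 (inr x)); first by apply: eq_computes cU => x; rewrite e1.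
  by move=> i j; rewrite e2 -!outE.
case=> L cL [U cU outE].
pose v1 (x : input n s + T) := match x with inl y => inp y | inr y => L y end.
pose v2 (x : input n s + T + T) :=
  match x with inl y => v1 y | inr y => U y end.
apply/computes_seqp; exists v1; first by apply/computes_carry.
apply/computes_seqp; exists v2.
  by apply/computes_carry; split=> //; apply/computes_wire_seqp.
by apply/computes_wire => -[[] i j] /=; case: (outE i j).
Qed.

End GaussJordan.

(* The number of operations is bounded by a two-variable polynomial Q in n and
   s, and the program depends on n and s only.  Every application of * made by
   the program is subject to the convention that the closure is well-defined
   ([executable]); this holds as soon as every element of S whose powers are
   all dominated by one diagonal entry of the upper bound of A^* has a
   closure. *)
Theorem mainTheorem2 :
  exists (Q : {poly {poly nat}})
         (P : forall n s : nat, program (input n s) (output n s)),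
    (forall n s : nat, (cost (P n s) <= Q.[s%:P].[n])%N) /\
    forall (S : nzSemiRingType) (n s : nat)
           (A : 'M[S * S]_n) (B : 'M[S * S]_(n, s)),
      idempotent_semiring S ->
      strong_well_defined S ->
      strong_imx A ->
      strong_imx B ->
      (forall X : 'M[S]_n, in_imx A X -> exists Xs : 'M[S]_n, is_mxclosure X Xs) ->
      exists As : 'M[S * S]_n,
        [/\ is_imxclosure A As,
            least_interval (As *m B) (Sigma_min A B),
            executable (P n s) (input_val A B) ->
              computes (P n s) (input_val A B) (output_val (As *m B)) &
            (forall x : S,
               (exists i : 'I_n, forall k : nat, canle (x ^+ k) (As i i).2) ->
               exists y : S, is_closure x y) ->
            executable (P n s) (input_val A B)].
Proof.
(* In Q the outer variable stands for s and the inner one for n. *)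
pose Q : {poly {poly nat}} :=
  'X%:P * (1 + ('X%:P + 'X) + 'X%:P * ('X%:P + 'X) * 2%:R) * 2%:R.
exists Q, solve_interval; split=> [n s | S n s A B Sid _ sA sB cloA].
  by rewrite cost_solve_interval /Q !hornerE.
have low_le m p (C : 'M[S * S]_(m, p)) : strong_imx C -> mxle (lowmx C) (upmx C).
  move=> sC i j; rewrite !mxE; case: (sC i j) => [[_ //] | ->].
  exact: canle_refl.
have leA := low_le _ _ _ sA; have leB := low_le _ _ _ sB.
have [L cL] : exists L, is_mxclosure (lowmx A) L.
  by apply: cloA; split=> //; exact: mxle_refl.
have [U cU] : exists U, is_mxclosure (upmx A) U.
  by apply: cloA; split=> //; exact: mxle_refl.
pose As : 'M[S * S]_n := \matrix_(i, j) (L i j, U i j).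
have lowAs : lowmx As = L by apply/matrixP=> i j; rewrite !mxE.
have upAs : upmx As = U by apply/matrixP=> i j; rewrite !mxE.
have cAs : is_imxclosure A As by rewrite /is_imxclosure lowAs upAs.
exists As; split=> //.
- exact: closure_intervalP.
- case/executableE => out /computes_solve_interval[M cM [W cW _]].
  apply/computes_solve_interval; exists M => //; exists W => // i j.
  have -> : output_val (As *m B) (EntryC Lower i j) = (L *m lowmx B) i j.
    by rewrite -lowAs -lowmx_mul mxE.
  have -> : output_val (As *m B) (EntryC Upper i j) = (U *m upmx B) i j.
    by rewrite -upAs -upmx_mul mxE.
  by split; [exact: (solve_bound_sound (b := Lower) Sid cL cM) |
             exact: (solve_bound_sound (b := Upper) Sid cU cW)].
(* The pivots of the lower tableau are dominated by the diagonal of L, hence by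
   that of U, which is the one the hypothesis speaks of. *)
move=> clo; have LU := mxclosure_mono Sid cL cU leA.
have [x i xU|W cW] := eliminate_total Sid (upmx B) cU (enum 'I_n).
  by apply: clo; exists i => k; rewrite mxE; exact: xU.
have [x i xL|M cM] := eliminate_total Sid (lowmx B) cL (enum 'I_n).
  by apply: clo; exists i => k; rewrite mxE; apply: canle_trans (xL k) (LU i i).
apply/executableE; exists (fun o => match o with
  | EntryC Lower i j => M (i, inr j) | EntryC Upper i j => W (i, inr j) end).
apply/computes_solve_interval; exists M; first exact/computes_solve_bound.
by exists W; first exact/computes_solve_bound.
Qed.
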